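(* Let $\mathcal S$ be a finite state space, let $\pi$ be a stationary policy with induced transition probabilities $p^\pi(s'|s)$ (transition matrix $P^\pi$), let $\gamma\in[0,1)$ and $\lambda\in[0,1]$, and let $\Phi^\pi_\lambda$ be the $\lambda$ representation of $\pi$. Then for all $s,s'\in\mathcal S$, $$\Phi^\pi_\lambda(s,s')=\mathbb 1(s=s')\Big(1+\gamma\lambda\,\mathbb E_{s_{t+1}\sim p^\pi(\cdot|s)}\Phi^\pi_\lambda(s_{t+1},s')\Big)+\gamma\,(1-\mathbb 1(s=s'))\,\mathbb E_{s_{t+1}\sim p^\pi(\cdot|s)}\Phi^\pi_\lambda(s_{t+1},s').$$ Equivalently, $\mathcal G^\pi_\lambda\Phi^\pi_\lambda=\Phi^\pi_\lambda$, where for $\Phi\in\mathbb R^{|\mathcal S|\times|\mathcal S|}$ $$\mathcal G^\pi_\lambda\Phi = I\odot(\mathbf 1\mathbf 1^\top+\gamma\lambda P^\pi\Phi)+\gamma(\mathbf 1\mathbf 1^\top-I)\odot P^\pi\Phi .$$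
   Context: The MDP has finite state space $\mathcal S$, action set $\mathcal A$, transition kernel $p(s'|s,a)$ and discount factor $\gamma\in[0,1)$. A stationary policy is a map $\pi:\mathcal S\to\mathcal P(\mathcal A)$ into probability distributions on actions; $P^\pi_{s,s'}=p^\pi(s'|s)=\sum_a p(s'|s,a)\pi(a|s)$. The $\lambda$ representation is $$\Phi^\pi_\lambda(s,s')=\mathbb E_\pi\Big[\sum_{k=0}^\infty\lambda^{n_t(s',k)}\gamma^k\,\mathbb 1(s_{t+k}=s')\,\Big|\,s_t=s\Big],\qquad n_t(s',k)=\sum_{j=0}^{k-1}\mathbb 1(s_{t+j}=s'),$$ where the expectation is over trajectories generated by $\pi$ and $p$, and $0^0=1$. $\odot$ is the elementwise product, $I$ the identity matrix, and $\mathbf 1\mathbf 1^\top$ the all-ones matrix. *)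

(* Defs.v *)
From HB Require Import structures.
From mathcomp Require Import all_boot all_order all_algebra.
From mathcomp Require Import all_classical all_reals all_analysis.

Set Implicit Arguments.
Unset Strict Implicit.
Unset Printing Implicit Defensive.

Import Order.TTheory GRing.Theory Num.Theory.
Import numFieldNormedType.Exports.

Local Open Scope classical_set_scope.
Local Open Scope ring_scope.

(* The action set is an arbitrary choiceType: distributions on actions are
   discrete, given by mass functions whose total mass is an unordered sum. *)
Record mdp (R : realType) (S : finType) (A : choiceType) := MDP {
  trans : S -> A -> S -> R ;
  trans_ge0 : forall s a s', 0 <= trans s a s' ;
  trans_sum1 : forall s a, \sum_(s' : S) trans s a s' = 1 }.

Record policy (R : realType) (S : finType) (A : choiceType) := Policy {
  act : S -> A -> R ;
  act_ge0 : forall s a, 0 <= act s a ;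
  act_sum1 : forall s, (\esum_(a in [set: A]) (act s a)%:E = 1)%E }.

Section Definitions.
Context (R : realType) (S : finType) (A : choiceType).
Implicit Types (M : mdp R S A) (pi : policy R S A) (s : S).

(* p^pi(s' | s) = sum_a p(s' | s, a) pi(a | s); the sum is at most 1, hence
   finite. *)
Definition ptrans M pi s (s' : S) : R :=
  fine (\esum_(a in [set: A]) (trans M s a s' * act pi s a)%:E)%E.

(* E_{s1 ~ p^pi(. | s)} [f s1] *)
Definition expect_next M pi s (f : S -> R) : R :=
  \sum_(s1 : S) ptrans M pi s s1 * f s1.

(* (St k, At k)_k is the state-action process, and Pr is the conditional
   probability given s_t = s: from time t on, the process starts at s, draws
   its actions from pi and its successor states from the kernel of M.  The
   finite-dimensional distributions are those of the trajectory
   x 0, a 0, x 1, a 1, ..., a n.-1, x n. *)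
Record generated_from M pi (t : nat) s
    (d : measure_display) (W : measurableType d) (Pr : probability W R)
    (St : nat -> W -> S) (At : nat -> W -> A) : Prop := GeneratedFrom {
  measurable_state : forall k x, measurable [set w | St k w = x] ;
  measurable_action : forall k b, measurable [set w | At k w = b] ;
  trajectory_law : forall (n : nat) (x : nat -> S) (a : nat -> A),
    Pr [set w | (forall k, (k <= n)%N -> St (t + k)%N w = x k) /\
                (forall k, (k < n)%N -> At (t + k)%N w = a k)] =
    ((x 0%N == s)%:R *
     \prod_(k < n) (act pi (x k) (a k) * trans M (x k) (a k) (x k.+1)))%:E }.

(* n_t(s', k), for a trajectory y of states *)
Definition visits (y : nat -> S) (t : nat) (s' : S) (k : nat) : nat :=
  (\sum_(0 <= j < k) (y (t + j)%N == s'))%N.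

(* The series converges (its k-th term lies in [0, gamma ^+ k]); in this ring
   x ^+ 0 = 1 for every x, including x = 0. *)
Definition lambda_return (gamma lambda : R) (y : nat -> S) (t : nat) (s' : S) : R :=
  limn (series (fun k : nat =>
    lambda ^+ visits y t s' k * gamma ^+ k * (y (t + k)%N == s')%:R)).

(* Pr s stands for the conditional probability given s_t = s.  The integrand
   is bounded, so the expectation is finite. *)
Definition lambda_rep (gamma lambda : R)
    (d : measure_display) (W : measurableType d) (Pr : S -> probability W R)
    (St : nat -> W -> S) (t : nat) (s s' : S) : R :=
  fine ('E_(Pr s)[fun w => lambda_return gamma lambda (St ^~ w) t s'])%E.

(* Matrices indexed by states, through the enumeration of S. *)
Definition mx_of (f : S -> S -> R) : 'M[R]_#|S| :=
  \matrix_(i, j) f (enum_val i) (enum_val j).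

Definition hadamard (m n : nat) (X Y : 'M[R]_(m, n)) : 'M[R]_(m, n) :=
  map2_mx *%R X Y.

Definition bellman_op M pi (gamma lambda : R) (F : 'M[R]_#|S|) : 'M[R]_#|S| :=
  let P := mx_of (ptrans M pi) in
  hadamard 1%:M (const_mx 1 + (gamma * lambda) *: (P *m F)) +
  gamma *: hadamard (const_mx 1 - 1%:M) (P *m F).

End Definitions.

(* Main.v *)
Require Import Defs.
From HB Require Import structures.
From mathcomp Require Import all_boot all_order all_algebra.
From mathcomp Require Import finmap.
From mathcomp Require Import all_classical all_reals all_analysis.
From mathcomp Require Import measurable_realfun.
From mathcomp Require Import ring.

Set Implicit Arguments.
Unset Strict Implicit.
Unset Printing Implicit Defensive.

Import Order.TTheory GRing.Theory Num.Theory.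
Import numFieldNormedType.Exports.

Local Open Scope ring_scope.

(** A state path has probability at least the product of the [ptrans]'s, by
    summing the trajectory law over finite sets of actions; the two sides have
    equal total mass over the paths of a given length, so they agree.  Hence the
    n-step truncations of the return satisfy, in expectation, the recursion
    V (n+1) s = 1(s = s') + gamma lambda^1(s = s') E V n, and the truncations
    increase to the return, so that monotone convergence gives the fixed point. *)

(** * Splitting measures and integrals along the fibers of a discrete map *)

Section Fibers.
Local Open Scope classical_set_scope.
Context d (W : measurableType d) (R : realType).
Variable mu : {measure set W -> \bar R}.

Lemma ge0_integral_fibers (I : finType) (X : W -> I) (D : set W)
    (f : W -> \bar R) :
  measurable D -> (forall i, measurable [set w | X w = i]) ->
  measurable_fun setT f -> (forall w, (0 <= f w)%E) ->
  (\int[mu]_(w in D) f w =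
   \sum_(i : I) \int[mu]_(w in D `&` [set w | X w = i]) f w)%E.
Proof.
move=> mD mX mf f0.
have DE : D = \big[setU/set0]_(i : I) (D `&` [set w | X w = i]).
  rewrite -bigcup_seq; apply/seteqP; split=> [w Dw|w [i _ []//]].
  by exists (X w) => //=; rewrite mem_index_enum.
rewrite {1}DE ge0_integral_bigsetU//.
- by move=> i; exact: measurableI.
- exact: index_enum_uniq.
- by move=> i j _ _ [w [[_ /= <-] [_ /= <-]]].
- exact: measurable_funTS.
Qed.

Lemma measure_fibers (I : finType) (X : W -> I) (D : set W) :
  measurable D -> (forall i, measurable [set w | X w = i]) ->
  (mu D = \sum_(i : I) mu (D `&` [set w | X w = i]))%E.
Proof.
move=> mD mX; have := @ge0_integral_fibers I X D (cst 1%E) mD mX.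
rewrite integral_cst// mul1e => ->//.
by apply: eq_bigr => i _; rewrite integral_cst ?mul1e//; exact: measurableI.
Qed.

(** [I] may be uncountable here, so only finitely many fibers are taken: their disjoint union lies
    inside [D], which leaves an inequality. *)
Lemma sum_measure_fibers_le (I : choiceType) (X : W -> I) (D : set W)
    (F : {fset I}) :
  measurable D -> (forall i, measurable [set w | X w = i]) ->
  (\sum_(i <- F) mu (D `&` [set w | X w = i]) <= mu D)%E.
Proof.
move=> mD mX; have mDX i : measurable (D `&` [set w | X w = i]).
  exact: measurableI.
rewrite -measure_fbigsetU//; last by move=> i j _ _ [w [[_ /= <-] [_ /= <-]]].
rewrite le_measure ?inE//; first exact: bigsetU_measurable.
by rewrite -bigcup_fset => w [i _ []].
Qed.

End Fibers.

(** An unordered sum is the supremum of its finite partial sums, so a bound on all of these passes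
    to it after division by [c]. When [c] is 0, the empty partial sum already gives [0 <= p]. *)
Lemma esum_scaled_le (R : realType) (T : choiceType) (f : T -> R) (c e p : R) :
  0 <= c -> (forall x, 0 <= f x) ->
  (forall F : {fset T}, c * \sum_(x <- F) f x <= p) ->
  (\esum_(x in [set: T]) (f x)%:E)%E = e%:E -> c * e <= p.
Proof.
move=> c0 f0 cF fe.
have [->|cn0] := eqVneq c 0; first by have := cF fset0; rewrite big_nil mulr0 mul0r.
have cp : 0 < c by rewrite lt_neqAle eq_sym cn0.
rewrite -ler_pdivlMl// -lee_fin -fe.
apply: ge_ereal_sup => _ [X [finX _] <-].
by rewrite fsbig_finite//= sumEFin lee_fin ler_pdivlMl.
Qed.

(** * The Markov chain on states induced by the policy *)

Section InducedChain.
Context (R : realType) (S : finType) (A : choiceType).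
Variables (M : mdp R S A) (pi : policy R S A).

Lemma trans_le1 s a s' : trans M s a s' <= 1.
Proof.
by rewrite -(trans_sum1 M s a) (bigD1 s')//= lerDl sumr_ge0// => i _; exact: trans_ge0.
Qed.

Lemma trans_act_ge0 s s' a : 0 <= trans M s a s' * act pi s a.
Proof. by rewrite mulr_ge0 ?trans_ge0 ?act_ge0. Qed.

(** The sum is dominated by the total mass 1 of [act pi s], so [fine] loses nothing in the
    definition of [ptrans]. *)
Lemma ptransE s s' :
  (\esum_(a in [set: A]) (trans M s a s' * act pi s a)%:E)%E =
  (ptrans M pi s s')%:E.
Proof.
rewrite fineK// ge0_fin_numE; last first.
  by apply: esum_ge0 => a _; rewrite lee_fin trans_act_ge0.
apply: (@le_lt_trans _ _ 1%E); last exact: ltry.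
rewrite -(act_sum1 pi s); apply: le_esum => a _.
by rewrite lee_fin ler_piMl ?act_ge0 ?trans_le1.
Qed.

Lemma ptrans_ge0 s s' : 0 <= ptrans M pi s s'.
Proof.
rewrite -lee_fin -ptransE.
by apply: esum_ge0 => a _; rewrite lee_fin trans_act_ge0.
Qed.

Lemma ptrans_sum1 s : \sum_(s' : S) ptrans M pi s s' = 1.
Proof.
apply/eqP; rewrite -eqe -sumEFin -(act_sum1 pi s).
under eq_bigr do rewrite -ptransE.
rewrite -esum_sum; last by move=> a s' _ _; rewrite lee_fin trans_act_ge0.
apply/eqP/eq_esum => a _.
by rewrite sumEFin -mulr_suml trans_sum1 mul1r.
Qed.

(** An empty action set could not carry mass 1. The action obtained here provides the action
    sequence that [trajectory_law] takes as argument even when no action is constrained. *)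
Lemma policy_action (s : S) : inhabited A.
Proof.
have [//|noA] := pselect (inhabited A).
have A0 : [set: A]%classic = set0.
  by apply/seteqP; split=> // a _; apply: noA; exists.
by have := act_sum1 pi s; rewrite A0 esum_set0 => /eqP; rewrite eqe eq_sym oner_eq0.
Qed.

End InducedChain.

(** * The law of the state paths *)

Section PathLaw.
Local Open Scope classical_set_scope.
Context (R : realType) (S : finType) (A : choiceType).
Variables (M : mdp R S A) (pi : policy R S A) (t : nat) (s : S).
Context d (W : measurableType d).
Variables (Pr : probability W R) (St : nat -> W -> S) (At : nat -> W -> A).
Hypothesis gen : generated_from M pi t s Pr St At.

(** The horizons for actions and states are separate, so that actions can be summed out while the
    state path stays fixed: [m = n] is the event of [trajectory_law], and [m = 0] leaves a pure
    state path. *)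
Definition trajectory_event m n (x : nat -> S) (a : nat -> A) : set W :=
  [set w | (forall k, (k <= n)%N -> St (t + k)%N w = x k) /\
           (forall k, (k < m)%N -> At (t + k)%N w = a k)].

Definition path_event n (x : nat -> S) : set W :=
  [set w | forall k, (k <= n)%N -> St (t + k)%N w = x k].

Definition path_prob n (x : nat -> S) : R :=
  (x 0%N == s)%:R * \prod_(0 <= k < n) ptrans M pi (x k) (x k.+1).

Lemma measurable_path_event n x : measurable (path_event n x).
Proof.
have -> : path_event n x =
    \bigcap_(k in [set k | (k <= n)%N]) [set w | St (t + k)%N w = x k] by [].
by apply: bigcap_measurableType => k _; exact: (measurable_state gen).
Qed.

Lemma measurable_trajectory_event m n x a :
  measurable (trajectory_event m n x a).
Proof.
have -> : trajectory_event m n x a = path_event n x `&`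
    \bigcap_(k in [set k | (k < m)%N]) [set w | At (t + k)%N w = a k] by [].
apply: measurableI; first exact: measurable_path_event.
by apply: bigcap_measurableType => k _; exact: (measurable_action gen).
Qed.

Lemma trajectory_event0 n x a : trajectory_event 0 n x a = path_event n x.
Proof. by apply/seteqP; split=> w //= []. Qed.

Lemma path_prob_ge0 n x : 0 <= path_prob n x.
Proof. by rewrite mulr_ge0// prodr_ge0// => k _; exact: ptrans_ge0. Qed.

Lemma path_event_extend n x s1 :
  path_event n x `&` [set w | St (t + n.+1)%N w = s1] =
  path_event n.+1 [eta x with n.+1 |-> s1].
Proof.
apply/seteqP; split=> w /=.
  move=> [px ps] k; rewrite leq_eqVlt => /orP[/eqP->|kn] /=; first by rewrite eqxx.
  by rewrite /= ltn_eqF// px.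
move=> px; split=> [k kn|]; last by rewrite px//= eqxx.
by rewrite px ?leqW//= ltn_eqF.
Qed.

Lemma path_prob_extend n x s1 :
  path_prob n.+1 [eta x with n.+1 |-> s1] =
  path_prob n x * ptrans M pi (x n) s1.
Proof.
rewrite /path_prob big_nat_recr//= eqxx ltn_eqF// mulrA; congr (_ * _ * _).
by apply: eq_big_nat => k /andP[_ kn] /=; rewrite !ltn_eqF// ltnS ltnW.
Qed.

Lemma trajectory_event_extend m n x a b :
  trajectory_event m n x a `&` [set w | At (t + m)%N w = b] =
  trajectory_event m.+1 n x [eta a with m |-> b].
Proof.
apply/seteqP; split=> w /=.
  move=> [[px pa] ab]; split=> // k; rewrite ltnS leq_eqVlt => /orP[/eqP->|km].
    by rewrite /= eqxx.
  by rewrite /= ltn_eqF// pa.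
move=> [px pa]; split; last by rewrite pa//= eqxx.
by split=> // k km; rewrite pa ?leqW//= ltn_eqF.
Qed.

(* Actions are summed out one at a time, from the last one: since A may be
   uncountable, only finitely many values at once, which gives a lower bound. *)
Lemma trajectory_event_ge j m x a :
  (((x 0%N == s)%:R *
    \prod_(0 <= k < m) (act pi (x k) (a k) * trans M (x k) (a k) (x k.+1)) *
    \prod_(m <= k < m + j) ptrans M pi (x k) (x k.+1))%:E
  <= Pr (trajectory_event m (m + j) x a))%E.
Proof.
elim: j m a => [|j IH] m a.
  rewrite addn0 (@big_geq _ _ _ m m)// mulr1 big_mkord.
  by rewrite -(trajectory_law gen m x a).
set D := trajectory_event _ _ _ _.
have mD : measurable D by exact: measurable_trajectory_event.
have PD : (fine (Pr D))%:E = Pr D by rewrite fineK// fin_num_measure.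
(* The product is split at time [m]: [c] still involves chosen actions, [c'] is the tail after the
   transition from [x m], and the factor between them is the unordered sum over the action at time
   [m]. *)
set c := _%:R * _; rewrite (@big_ltn _ _ _ m) ?addnS ?ltnS ?leq_addr// -addSn.
set c' := \prod_(_ <= k < _) _.
have c'0 : 0 <= c' by rewrite prodr_ge0// => k _; exact: ptrans_ge0.
have c0 : 0 <= c.
  by rewrite mulr_ge0// prodr_ge0// => k _; rewrite mulr_ge0 ?act_ge0 ?trans_ge0.
rewrite -PD lee_fin mulrCA mulrC.
apply: (esum_scaled_le _ _ _ (ptransE M pi (x m) (x m.+1))).
- exact: mulr_ge0.
- by move=> b; exact: trans_act_ge0.
move=> F; rewrite -lee_fin PD; apply: le_trans (sum_measure_fibers_le Pr F mD
  (fun b => measurable_action gen (t + m) b)).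
rewrite mulr_sumr -sumEFin; apply: lee_sum => b _.
rewrite trajectory_event_extend addnS -addSn; apply: le_trans (IH _ _).
rewrite lee_fin big_nat_recr//= eqxx le_eqVlt; apply/orP; left; apply/eqP.
rewrite (eq_big_nat _ _ (F2 := fun k => act pi (x k) (a k) * trans M (x k) (a k) (x k.+1))).
  by rewrite -/c' /c; ring.
by move=> k /andP[_ km]; rewrite ltn_eqF.
Qed.

Lemma path_prob_le n x : ((path_prob n x)%:E <= Pr (path_event n x))%E.
Proof.
have [a] := policy_action pi s.
rewrite -(trajectory_event0 n x (fun=> a)).
by have := trajectory_event_ge n 0 x (fun=> a); rewrite big_nil mulr1 add0n.
Qed.

Lemma path_law n x : Pr (path_event n x) = (path_prob n x)%:E.
Proof.
elim: n x => [|n IH] x.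
  have [a] := policy_action pi s.
  rewrite /path_prob big_nil mulr1 -(trajectory_event0 0 x (fun=> a)).
  by have := trajectory_law gen 0 x (fun=> a); rewrite big_ord0 mulr1.
(* The true probabilities [q] of the one-step extensions dominate the products [r]. Both families
   sum to the probability of the path up to [n], so the nonnegative differences [q s1 - r s1] all
   vanish. *)
pose q s1 := fine (Pr (path_event n.+1 [eta x with n.+1 |-> s1])).
have qE s1 : Pr (path_event n.+1 [eta x with n.+1 |-> s1]) = (q s1)%:E.
  by rewrite fineK// fin_num_measure//; exact: measurable_path_event.
pose r s1 := path_prob n.+1 [eta x with n.+1 |-> s1].
have rq s1 : r s1 <= q s1 by rewrite -lee_fin -qE path_prob_le.
have sumq : \sum_s1 q s1 = \sum_s1 r s1.
  rewrite (eq_bigr _ (fun s1 _ => path_prob_extend n x s1)) -mulr_sumr.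
  rewrite ptrans_sum1 mulr1; apply/eqP; rewrite -eqe -IH -sumEFin; apply/eqP.
  rewrite (measure_fibers Pr (measurable_path_event n x)
    (measurable_state gen (t + n.+1))).
  by apply: eq_bigr => s1 _; rewrite path_event_extend; exact: esym (qE s1).
have /psumr_eq0P : \sum_s1 (q s1 - r s1) = 0 by rewrite sumrB sumq subrr.
move=> /(_ (fun s1 _ => etrans (subr_ge0 _ _) (rq s1)) (x n.+1) isT) /subr0_eq qr.
have xE : x = [eta x with n.+1 |-> x n.+1] :> (nat -> S).
  by apply/funext => k /=; case: eqP => // ->.
by rewrite xE qE qr.
Qed.

End PathLaw.

(** * Truncated returns and the recursion for their values *)

Section TruncatedReturn.
Context (R : realType) (S : finType).
Variables (gamma lambda : R) (s' : S).

Definition return_term (y : nat -> S) (t k : nat) : R :=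
  lambda ^+ visits y t s' k * gamma ^+ k * (y (t + k)%N == s')%:R.

Lemma visits_recl (y : nat -> S) t k :
  visits y t s' k.+1 = ((y t == s') + visits y t.+1 s' k)%N.
Proof.
rewrite /visits big_nat_recl//= addn0; congr addn.
by apply: eq_bigr => j _; rewrite addSnnS.
Qed.

(** A visit to [s'] at time [t] is counted in the exponent of every later term, hence contributes
    one common factor [lambda]; the shift in time contributes one [gamma]. *)
Lemma return_term_recl y t k :
  return_term y t k.+1 =
  gamma * lambda ^+ (y t == s') * return_term y t.+1 k.
Proof. by rewrite /return_term visits_recl exprD exprS addSnnS; ring. Qed.

Lemma series_return_termS y t n :
  series (return_term y t) n.+1 =
  (y t == s')%:R +
  gamma * lambda ^+ (y t == s') * series (return_term y t.+1) n.
Proof.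
rewrite /series /= big_nat_recl//; congr (_ + _).
  by rewrite /return_term /visits big_nil !expr0 !mul1r addn0.
by rewrite mulr_sumr; apply: eq_bigr => k _; exact: return_term_recl.
Qed.

Hypotheses (gamma01 : 0 <= gamma < 1) (lambda01 : 0 <= lambda <= 1).

Let gamma_ge0 : 0 <= gamma. Proof. by have [] := andP gamma01. Qed.
Let lambda_ge0 : 0 <= lambda. Proof. by have [] := andP lambda01. Qed.

Lemma return_term_ge0 y t k : 0 <= return_term y t k.
Proof. by rewrite /return_term !mulr_ge0 ?exprn_ge0. Qed.

Lemma return_term_le y t k : return_term y t k <= geometric 1 gamma k.
Proof.
case/andP: lambda01 => l0 l1.
rewrite /return_term /geometric/= mul1r -[leRHS]mulr1 ler_pM ?mulr_ge0 ?exprn_ge0//.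
  by rewrite ler_piMl ?exprn_ge0 ?exprn_ile1.
by rewrite lern1 leq_b1.
Qed.

Lemma is_cvg_series_return_term y t : cvgn (series (return_term y t)).
Proof.
apply: (@series_le_cvg _ _ (geometric 1 gamma)).
- exact: return_term_ge0.
- by move=> n; rewrite /geometric/= mul1r exprn_ge0.
- exact: return_term_le.
by apply: is_cvg_geometric_series; case/andP: gamma01 => g0 g1; rewrite ger0_norm.
Qed.

Lemma series_return_term_ge0 y t n : 0 <= series (return_term y t) n.
Proof. by rewrite sumr_ge0// => k _; exact: return_term_ge0. Qed.

Lemma nondecreasing_series_return_term y t :
  {homo series (return_term y t) : n m / (n <= m)%N >-> n <= m}.
Proof. by apply: nondecreasing_series => n _ _; exact: return_term_ge0. Qed.

Section Value.
Context (A : choiceType) (M : mdp R S A) (pi : policy R S A).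

(** This is value iteration started from 0. The exponent [(s == s')] merges the two cases of the
    Bellman equation, with factor [lambda] at [s'] and 1 elsewhere, also when [lambda] is 0. *)
Fixpoint truncated_value (n : nat) (s : S) : R :=
  if n is n'.+1 then
    (s == s')%:R +
    gamma * lambda ^+ (s == s') * expect_next M pi s (truncated_value n')
  else 0.

Lemma truncated_value_ge0 n s : 0 <= truncated_value n s.
Proof.
elim: n s => [//|n IH] s /=; rewrite addr_ge0 ?mulr_ge0 ?exprn_ge0//.
by rewrite sumr_ge0// => s1 _; rewrite mulr_ge0 ?ptrans_ge0.
Qed.

Lemma truncated_value_leS n s : truncated_value n s <= truncated_value n.+1 s.
Proof.
elim: n s => [|n IH] s; first exact: truncated_value_ge0.
rewrite /= lerD2l ler_wpM2l ?mulr_ge0 ?exprn_ge0//.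
by apply: ler_sum => s1 _; rewrite ler_wpM2l ?ptrans_ge0//; exact: IH.
Qed.

Lemma truncated_value_le n s : truncated_value n s <= (1 - gamma)^-1.
Proof.
case/andP: gamma01 => g0 g1; case/andP: lambda01 => l0 l1.
have g1' : 0 < 1 - gamma by rewrite subr_gt0.
elim: n s => [|n IH] s /=; first by rewrite invr_ge0 ltW.
(* The bound is the solution of [v = 1 + gamma * v], so it reproduces itself under the recursion. *)
have -> : (1 - gamma)^-1 = 1 + gamma * (1 - gamma)^-1.
  by field; rewrite gt_eqF.
apply: lerD; first by rewrite lern1 leq_b1.
rewrite -mulrA ler_wpM2l// -[leRHS]mul1r.
apply: ler_pM; rewrite ?exprn_ge0 ?exprn_ile1//.
  by rewrite sumr_ge0// => s1 _; rewrite mulr_ge0 ?ptrans_ge0 ?truncated_value_ge0.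
rewrite -[leRHS]mul1r -[X in X * _](ptrans_sum1 M pi s) mulr_suml.
by apply: ler_sum => s1 _; rewrite ler_wpM2l ?ptrans_ge0//; exact: IH.
Qed.

Lemma is_cvg_truncated_value s : cvgn (truncated_value ^~ s).
Proof.
apply: nondecreasing_is_cvgn.
  by apply/nondecreasing_seqP => n; exact: truncated_value_leS.
by exists (1 - gamma)^-1 => _ [n _ <-]; exact: truncated_value_le.
Qed.

Lemma cvg_expect_next (u : nat -> S -> R) (l : S -> R) s :
  (forall s1, u ^~ s1 @ \oo --> l s1)%classic ->
  (expect_next M pi s (u n) @[n --> \oo] --> expect_next M pi s l)%classic.
Proof.
move=> ul; rewrite /expect_next.
elim: (index_enum S) => [|s1 r IH].
  rewrite big_nil (_ : (fun=> _) = cst 0); first exact: cvg_cst.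
  by apply/funext => n; rewrite big_nil.
rewrite big_cons.
under eq_fun do rewrite big_cons.
by apply: cvgD => //; apply: cvgM => //; exact: cvg_cst.
Qed.

Lemma lim_truncated_value s :
  limn (truncated_value ^~ s) =
  (s == s')%:R + gamma * lambda ^+ (s == s') *
    expect_next M pi s (fun s1 => limn (truncated_value ^~ s1)).
Proof.
(* Shifting the index by one keeps the limit and exposes the recursion, in which each term
   converges. *)
apply/cvg_lim => //; rewrite -(cvg_shiftS (truncated_value ^~ s)) /=.
apply: cvgD; first exact: cvg_cst.
apply: cvgM; first exact: cvg_cst.
by apply: cvg_expect_next => s1; exact: is_cvg_truncated_value.
Qed.

End Value.
End TruncatedReturn.

(** * Expectation of the return along the process *)

Section ExpectedReturn.
Local Open Scope classical_set_scope.
Context (R : realType) (S : finType) (A : choiceType).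
Variables (M : mdp R S A) (pi : policy R S A) (t : nat) (s : S).
Context d (W : measurableType d).
Variables (Pr : probability W R) (St : nat -> W -> S) (At : nat -> W -> A).
Hypothesis gen : generated_from M pi t s Pr St At.
Variables (gamma lambda : R) (s' : S).
Hypotheses (gamma01 : 0 <= gamma < 1) (lambda01 : 0 <= lambda <= 1).

Let ret n k w : R := series (return_term gamma lambda s' (St ^~ w) k) n.

Lemma measurable_state_eq (D : set W) k :
  measurable_fun D (fun w => (St k w == s')%:R : R).
Proof.
rewrite (_ : (fun w => _) = \1_[set w | St k w = s']).
  by apply: measurable_indic; exact: (measurable_state gen).
apply/funext => w; rewrite indicE; congr (_%:R); congr nat_of_bool.
by apply/eqP/idP; rewrite inE.
Qed.

Lemma measurable_truncated_return n k : measurable_fun setT (ret n k).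
Proof.
apply: measurable_sum => i; apply: measurable_funM; last exact: measurable_state_eq.
apply: measurable_funM; last exact: measurable_cst.
(* The power with random exponent becomes a finite product of affine functions of indicators, each
   equal to [lambda] on a visit and to 1 otherwise. *)
rewrite (_ : (fun w => _) = fun w =>
    \prod_(j <- index_iota 0 i) (1 + (lambda - 1) * (St (k + j)%N w == s')%:R)).
  apply: measurable_prod => j _; apply: measurable_funD; first exact: measurable_cst.
  apply: measurable_funM; [exact: measurable_cst|exact: measurable_state_eq].
apply/funext => w; rewrite /visits -prodrXr; apply: eq_bigr => j _.
by case: eqP => _ /=; ring.
Qed.

(* The Markov property: given the path up to time j, the expected n-step return
   from time t + j only depends on the current state. *)
Lemma integral_path_event_return n j x :
  (\int[Pr]_(w in path_event t St j x) (ret n (t + j) w)%:E =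
   (path_prob M pi s j x * truncated_value gamma lambda s' M pi n (x j))%:E)%E.
Proof.
elim: n j x => [|n IH] j x.
  rewrite mulr0 integral0_eq// => w _.
  by rewrite /ret /series /= big_nil.
set D := path_event _ _ _ _.
have mD : measurable D by exact: (measurable_path_event gen).
have [g0 _] := andP gamma01; have [l0 _] := andP lambda01.
set b := (x j == s').
(* On [D] the state at time [t + j] is [x j], so the indicator and the discount factor in the
   recursion are constants. *)
have retE w : D w -> (ret n.+1 (t + j) w)%:E =
    ((b%:R)%:E + (gamma * lambda ^+ b)%:E * (ret n (t + j.+1) w)%:E)%E.
  by move=> Dw; rewrite /ret series_return_termS Dw// addnS.
have ret0 w : (0 <= (ret n (t + j.+1) w)%:E)%E.
  by rewrite lee_fin series_return_term_ge0.
have mret : measurable_fun setT (fun w => (ret n (t + j.+1) w)%:E).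
  by apply/measurable_EFinP; exact: measurable_truncated_return.
have c0 : 0 <= gamma * lambda ^+ b by rewrite mulr_ge0 ?exprn_ge0.
rewrite (eq_integral (fun w => ((b%:R)%:E +
  (gamma * lambda ^+ b)%:E * (ret n (t + j.+1) w)%:E)%E)); last first.
  by move=> w; rewrite inE => /retE.
rewrite ge0_integralD//; last first.
- by apply: measurable_funTS; exact: measurable_funeM.
- by move=> w _; rewrite mule_ge0// lee_fin.
have intb : (\int[Pr]_(w in D) (b%:R)%:E = (b%:R * path_prob M pi s j x)%:E)%E.
  by rewrite integral_cst// EFinM; congr mule; exact: (path_law gen).
rewrite intb ge0_integralZl_EFin//; last exact: measurable_funTS.
(* Splitting by the next state turns [D] into path events up to time [j.+1], to which the induction
   hypothesis applies. *)
rewrite (ge0_integral_fibers Pr mD (measurable_state gen (t + j.+1)))//.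
under eq_bigr do rewrite path_event_extend IH path_prob_extend /= eqxx.
rewrite sumEFin -EFinM -EFinD /=; congr (_%:E).
rewrite mulrDr [b%:R * _]mulrC -/b; congr (_ + _).
rewrite /expect_next mulrCA; congr (_ * _).
by rewrite mulr_sumr; apply: eq_bigr => s1 _; rewrite mulrA.
Qed.

Lemma integral_truncated_return n :
  (\int[Pr]_w (ret n t w)%:E = (truncated_value gamma lambda s' M pi n s)%:E)%E.
Proof.
have mret : measurable_fun setT (fun w => (ret n t w)%:E).
  by apply/measurable_EFinP; exact: measurable_truncated_return.
rewrite (ge0_integral_fibers Pr measurableT (measurable_state gen t))//; last first.
  by move=> w; rewrite lee_fin series_return_term_ge0.
have E s1 : setT `&` [set w | St t w = s1] = path_event t St 0 (fun=> s1).
  rewrite setTI; apply/seteqP; split=> w /=.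
    by move=> ws k; rewrite leqn0 => /eqP->; rewrite addn0.
  by move=> /(_ 0%N isT); rewrite addn0.
have intE s1 : (\int[Pr]_(w in setT `&` [set w | St t w = s1]) (ret n t w)%:E =
    (path_prob M pi s 0 (fun=> s1) *
     truncated_value gamma lambda s' M pi n s1)%:E)%E.
  by rewrite E -(integral_path_event_return n 0 (fun=> s1)) addn0.
under eq_bigr do rewrite intE.
(* Only the start [s] has positive probability, because [path_prob] carries the factor
   [(x 0 == s)]. *)
rewrite (bigD1 s)//= big1 ?adde0.
  by rewrite /path_prob big_nil eqxx !mul1r.
by move=> s1 /negPf s1s; rewrite /path_prob s1s !mul0r.
Qed.

Lemma expectation_lambda_return :
  fine ('E_Pr[fun w => lambda_return gamma lambda (St ^~ w) t s'])%E =
  limn (truncated_value gamma lambda s' M pi ^~ s).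
Proof.
rewrite unlock.
(* The real limit is moved to the extended reals, where monotone convergence applies to the partial
   sums. *)
have E w : (lambda_return gamma lambda (St ^~ w) t s')%:E =
    limn (fun n => (ret n t w)%:E).
  by rewrite -EFin_lim//; exact: is_cvg_series_return_term.
under eq_integral do rewrite E.
rewrite monotone_convergence//; last first.
- move=> w _ n m nm; rewrite lee_fin.
  exact: nondecreasing_series_return_term.
- by move=> n w _; rewrite lee_fin series_return_term_ge0.
- by move=> n; apply/measurable_EFinP; exact: measurable_truncated_return.
under eq_fun do rewrite integral_truncated_return.
by rewrite EFin_lim//; exact: is_cvg_truncated_value.
Qed.

End ExpectedReturn.

(** * The Bellman equation, pointwise and in matrix form *)

Lemma mulmx_mx_of (R : realType) (S : finType) (f g : S -> S -> R) i j :
  (mx_of f *m mx_of g) i j =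
  \sum_(s1 : S) f (enum_val i) s1 * g s1 (enum_val j).
Proof.
rewrite mxE (big_enum_val (fun s1 => f _ s1 * g s1 _)).
by apply: eq_bigr => k _; rewrite !mxE.
Qed.

Theorem mainTheorem1 (R : realType) (S : finType) (A : choiceType)
    (M : mdp R S A) (pi : policy R S A) (gamma lambda : R)
    (hgamma : 0 <= gamma < 1) (hlambda : 0 <= lambda <= 1)
    (d : measure_display) (W : measurableType d) (Pr : S -> probability W R)
    (St : nat -> W -> S) (At : nat -> W -> A) (t : nat)
    (hgen : forall s : S, generated_from M pi t s (Pr s) St At) :
  let Phi := lambda_rep gamma lambda Pr St t in
  (forall s s' : S,
     Phi s s' =
       (s == s')%:R *
         (1 + gamma * lambda * expect_next M pi s (fun s1 => Phi s1 s')) +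
       gamma * (1 - (s == s')%:R) *
         expect_next M pi s (fun s1 => Phi s1 s')) /\
  bellman_op M pi gamma lambda (mx_of Phi) = mx_of Phi.
Proof.
move=> Phi.
have bellman s s' : Phi s s' =
    (s == s')%:R *
      (1 + gamma * lambda * expect_next M pi s (fun s1 => Phi s1 s')) +
    gamma * (1 - (s == s')%:R) * expect_next M pi s (fun s1 => Phi s1 s').
  have PhiE s1 : Phi s1 s' = limn (truncated_value gamma lambda s' M pi ^~ s1).
    exact: (expectation_lambda_return (hgen s1)).
  rewrite (_ : (fun s1 => Phi s1 s') =
    fun s1 => limn (truncated_value gamma lambda s' M pi ^~ s1)).
    rewrite PhiE lim_truncated_value//.
    (* The merged factor [gamma * lambda ^+ (s == s')] splits into [gamma * lambda] on the diagonal
       and [gamma] off it. *)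
    by case: (s == s') => /=; ring.
  by apply/funext => s1.
split=> //; apply/matrixP => i j.
rewrite /bellman_op /hadamard !mxE; move: (mulmx_mx_of (ptrans M pi) Phi i j).
rewrite mxE => ->; rewrite (bellman (enum_val i) (enum_val j)).
(* Injectivity of the enumeration identifies the entries of the identity matrix with the indicators
   of equal states. *)
by rewrite (inj_eq enum_val_inj) mulrA.
Qed.
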